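(* Let $(X,d)$ be a proper $\mathrm{CAT}(0)$-space. If $C(X,d)=1$ then $(X,d)$ is Gromov hyperbolic.
   Context: For a metric space $(X,d)$ and $\mu,\delta \geq 0$, say that $(X,d)$ satisfies the $(\mu,\delta)$-four-point inequality if for all $x,y,z,w\in X$, $d(x,y)+d(z,w)\le \mu\max\{d(x,z)+d(y,w),\ d(x,w)+d(y,z)\}+2\delta$. The quasi-hyperbolicity constant of $(X,d)$ is $C(X,d)=\inf\{\mu\geq 0\mid \text{there exists }\delta\geq 0\text{ such that }(X,d)\text{ satisfies the }(\mu,\delta)\text{-four-point inequality}\}$. $(X,d)$ is Gromov hyperbolic if it satisfies the $(1,\delta)$-four-point inequality for some $\delta\geq 0$. A metric space is proper if its closed bounded subsets are compact. A $\mathrm{CAT}(0)$-space is a geodesic metric space in which, for every geodesic triangle, the distance between any two points of the triangle is at most the Euclidean distance between the corresponding points of a comparison triangle in the Euclidean plane. *)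

(* Defs.v *)
From mathcomp Require Import all_boot all_order all_algebra.
From mathcomp Require Import all_classical all_reals all_analysis.

Set Implicit Arguments.
Unset Strict Implicit.
Unset Printing Implicit Defensive.

Import Order.TTheory GRing.Theory Num.Theory.

Local Open Scope classical_set_scope.
Local Open Scope ring_scope.

Section QuasiHyperbolicity.
Context {R : realType} (X : metricType R).
Implicit Types (x y z w : X) (A S : set X).

Definition four_point_inequality (mu delta : R) : Prop :=
  forall x y z w,
    mdist x y + mdist z w <=
      mu * Num.max (mdist x z + mdist y w) (mdist x w + mdist y z) + 2 * delta.

(* The set below contains 2 (take delta = 0 and use the triangle inequality)
   and is bounded below by 0, so the real-valued [inf] is a true infimum. *)
Definition quasi_hyperbolicity_constant : R :=
  inf [set mu : R | 0 <= mu /\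
        exists2 delta : R, 0 <= delta & four_point_inequality mu delta].

Definition gromov_hyperbolic : Prop :=
  exists2 delta : R, 0 <= delta & four_point_inequality 1 delta.

(* The library's [bounded_set] only concerns normed modules. *)
Definition metric_bounded A : Prop :=
  exists M : R, forall x y, A x -> A y -> mdist x y <= M.

Definition proper_space : Prop :=
  forall A, closed A -> metric_bounded A -> compact A.

(* A geodesic is a map on [0, l]; the values of [c] elsewhere are irrelevant. *)
Definition geodesic_path (c : R -> X) (l : R) x y : Prop :=
  [/\ 0 <= l, c 0 = x, c l = y &
      {in `[0, l] &, forall s t, mdist (c s) (c t) = `|s - t|}].

Definition geodesic_segment S x y : Prop :=
  exists c l, geodesic_path c l x y /\ S = c @` `[0, l].

Definition geodesic_space : Prop :=
  forall x y, exists c l, geodesic_path c l x y.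

(* Vertices are indexed cyclically: side [i] joins vertices [i] and [ordS i],
   the successor of [i] modulo 3. *)
Definition geodesic_triangle (v : 'I_3 -> X) (side : 'I_3 -> set X) : Prop :=
  forall i, geodesic_segment (side i) (v i) (v (ordS i)).

(* The library's norm on ['rV[R]_2] is the sup norm, not the Euclidean one. *)
Definition euclidean_dist (a b : 'rV[R]_2) : R :=
  Num.sqrt (\sum_(k < 2) (a 0 k - b 0 k) ^+ 2).

Definition euclidean_segment (a b : 'rV[R]_2) : set 'rV[R]_2 :=
  [set (1 - t) *: a + t *: b | t in `[0, 1]].

Definition comparison_triangle (v : 'I_3 -> X) (v' : 'I_3 -> 'rV[R]_2) : Prop :=
  forall i j, euclidean_dist (v' i) (v' j) = mdist (v i) (v j).

(* [x'] corresponds to the point [x] of side [i] *)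
Definition comparison_point (v : 'I_3 -> X) (v' : 'I_3 -> 'rV[R]_2)
    (i : 'I_3) x (x' : 'rV[R]_2) : Prop :=
  euclidean_segment (v' i) (v' (ordS i)) x' /\
  euclidean_dist (v' i) x' = mdist (v i) x.

(* Comparison triangles exist and are unique up to isometry, so quantifying
   over all of them is the same as choosing one. *)
Definition CAT0_space : Prop :=
  geodesic_space /\
  forall v side v', geodesic_triangle v side -> comparison_triangle v v' ->
  forall i j x y (x' y' : 'rV[R]_2), side i x -> side j y ->
    comparison_point v v' i x x' -> comparison_point v v' j y y' ->
    mdist x y <= euclidean_dist x' y'.

End QuasiHyperbolicity.

(* Main.v *)
Require Import Defs.
From mathcomp Require Import all_boot all_order all_algebra.
From mathcomp Require Import all_classical all_reals all_analysis.
From mathcomp Require Import ring lra.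

Import Order.TTheory GRing.Theory Num.Theory.

Local Open Scope classical_set_scope.
Local Open Scope ring_scope.

(** If the infimum defining [C(X,d)] is 1, the space satisfies the
    [(41/40, delta)]-four-point inequality for some [delta]. At the scale
    [h = 20 delta + 1] this says that the space looks roughly like a tree: in a
    quadrilateral with sides of order [h] the additive error [delta] is small
    compared to [h]. The CAT(0) condition propagates this to all scales.

    The mechanism is a strong contraction of geodesics towards a point [p]
    (lemma [contraction]). Let [u], [v] lie on a sphere around [p] at distance
    at most [3h/2], and move both by [h] towards [p], to [u'] and [v']. By
    CAT(0) comparison each diagonal of the quadrilateral [u u' v' v] has length
    at least [sqrt (h^2 + d(u',v')^2)], while the four-point inequality bounds
    the sum of the diagonals from above; these are compatible only if
    [d(u',v') <= h/2].

    Now follow a geodesic from [u] to [m] in steps of length [h], as long as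
    its points [w] satisfy [d(p,w) >= d(p,u) - d(u,w) >= r]. Going one step
    further towards [m] costs at most [h] in the distance between radial
    projections, and this step is paid for by moving [h] closer to [p], which
    reduces the accumulated [3h/2] to [h/2]. Hence the error never exceeds
    [3h/2], however long the geodesic is (lemma [fellow_travel]). Splitting
    [[u,v]] at its tripod point shows that [[p,u]] and [[p,v]] stay [3h]-close
    up to the Gromov product of [u] and [v] based at [p], which is Gromov
    hyperbolicity (lemma [almost_tree_gromov_hyperbolic]). *)

Section CAT0Hyperbolicity.
Context {R : realType} {X : metricType R}.
Implicit Types (p q u v m x y z : X) (h r s t : R).
Set Implicit Arguments.
Unset Strict Implicit.

(** * Points on geodesics *)

(** A point at distance [t] from [p] on a geodesic from [p] to [u]. Describing
    it by distances avoids naming the geodesic, so that the same point can be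
    used on every geodesic segment through it. *)
Definition point_at p u t q : Prop :=
  mdist p q = t /\ mdist q u = mdist p u - t.

Lemma geodesic_path_length (c : R -> X) (l : R) x y :
  geodesic_path c l x y -> l = mdist x y.
Proof.
move=> [l0 <- <- iso]; rewrite iso ?in_itv/= ?lexx ?l0//.
by rewrite sub0r normrN ger0_norm.
Qed.

Lemma point_at_exists x y t : geodesic_space X -> 0 <= t -> t <= mdist x y ->
  exists q, point_at x y t q.
Proof.
move=> geo t0 txy; have [c [l cl]] := geo x y.
have lE := geodesic_path_length cl; have [l0 c0 cy iso] := cl.
exists (c t); split.
  rewrite -{1}c0 iso ?in_itv/= ?lexx ?l0 ?t0 ?lE//.
  by rewrite sub0r normrN ger0_norm.
rewrite -{1}cy iso ?in_itv/= ?lexx ?l0 ?t0 ?lE//.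
by rewrite distrC ger0_norm// subr_ge0.
Qed.

(** The segment is the concatenation of geodesics from [x] to [q] and from [q]
    to [y]: since [d(x,q) + d(q,y) = d(x,y)], the triangle inequality leaves no
    room for a shortcut between the two halves. *)
Lemma geodesic_segment_through x y t q : geodesic_space X -> point_at x y t q ->
  exists2 S, geodesic_segment S x y & S q.
Proof.
move=> geo [xq qy].
have [c1 [a h1]] := geo x q; have [c2 [b h2]] := geo q y.
have aE := geodesic_path_length h1; have bE := geodesic_path_length h2.
have [a0 c10 c1a iso1] := h1; have [b0 c20 c2b iso2] := h2.
pose c s := if s <= a then c1 s else c2 (s - a).
have ca : c a = q by rewrite /c lexx.
exists (c @` `[0, a + b]); last by exists a => //=; rewrite in_itv/= a0 lerDl.
exists c, (a + b); split => //; split.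
- exact: addr_ge0.
- by rewrite /c a0.
- rewrite /c; case: ifPn => [ab|_]; last by rewrite addrC addKr.
  have b00 : b = 0 by lra.
  by rewrite b00 addr0 c1a -c2b b00 c20.
have key s t' : 0 <= s <= a -> a < t' <= a + b ->
    mdist (c1 s) (c2 (t' - a)) = t' - s.
  move=> /andP[s0 sa] /andP[at' tb].
  have e1 : mdist x (c1 s) = s.
    rewrite -c10 iso1 ?in_itv/= ?lexx ?s0 ?sa ?a0//.
    by rewrite sub0r normrN ger0_norm.
  have e2 : mdist (c1 s) q = a - s.
    rewrite -c1a iso1 ?in_itv/= ?lexx ?s0 ?sa ?a0//.
    by rewrite distrC ger0_norm// subr_ge0.
  have tI : 0 <= t' - a <= b by apply/andP; split; lra.
  have e3 : mdist q (c2 (t' - a)) = t' - a.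
    rewrite -c20 iso2 ?in_itv/= ?lexx ?b0//; case/andP: tI => ? ?.
    by rewrite sub0r normrN ger0_norm.
  have e4 : mdist (c2 (t' - a)) y = b - (t' - a).
    rewrite -c2b iso2 ?in_itv/= ?lexx ?b0//; case/andP: tI => ? ?.
    by rewrite distrC ger0_norm// subr_ge0.
  have := metric_triangle (c1 s) q (c2 (t' - a)).
  have := metric_triangle x (c1 s) y.
  have := metric_triangle (c1 s) (c2 (t' - a)) y.
  by rewrite e1 e2 e3 e4 => *; apply/eqP; rewrite eq_le; apply/andP; split; lra.
move=> s t'; rewrite !in_itv/= => /andP[s0 sl] /andP[t0 tl]; rewrite /c.
case: (leP s a) => sa; case: (leP t' a) => ta.
- by rewrite iso1 ?in_itv/= ?s0 ?t0.
- by rewrite key ?s0 ?ta ?sa// ler0_norm ?opprB//; lra.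
- by rewrite metric_sym key ?t0 ?ta ?sa// ger0_norm//; lra.
- rewrite iso2 ?in_itv/=; first by congr (`|_|); ring.
    by apply/andP; split; lra.
  by apply/andP; split; lra.
Qed.

Lemma point_at_extend p u t h u' u'' :
  point_at p u t u' -> point_at u' u h u'' ->
  point_at p u (t + h) u'' /\ point_at p u'' t u'.
Proof.
move=> [pu' u'u] [u'u'' u''u].
have := metric_triangle p u' u''; have := metric_triangle p u'' u => *.
have pu'' : mdist p u'' = t + h.
  by apply/eqP; rewrite eq_le; apply/andP; split; lra.
by split; split => //; lra.
Qed.

(** * Metric consequences of CAT(0) comparison *)

Definition plane_point (a b : R) : 'rV[R]_2 := \row_k (if k == 0 then a else b).

Lemma euclidean_dist_plane_point a b c d :
  euclidean_dist (plane_point a b) (plane_point c d)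
    = Num.sqrt ((a - c) ^+ 2 + (b - d) ^+ 2).
Proof. by rewrite /euclidean_dist big_ord_recl big_ord1 !mxE. Qed.

(** Stewart's formula computes the length of a cevian of a Euclidean triangle;
    comparison turns it into an upper bound. The comparison triangle has
    vertices [(0,0)], [(c,0)] and [(e,f)], and [q] corresponds to [(s,0)]. *)
Lemma stewart_le x y z q s : CAT0_space X ->
  0 <= s -> s <= mdist x y -> point_at x y s q ->
  mdist x y * mdist q z ^+ 2 <=
    (mdist x y - s) * mdist x z ^+ 2 + s * mdist y z ^+ 2
    - s * (mdist x y - s) * mdist x y.
Proof.
move=> [geo cat] s0 sc xqy.
have := mdist_ge0 x y; rewrite le_eqVlt => /predU1P[c0|c0].
  have -> : s = 0 by lra.
  by rewrite -c0; lra.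
have [S0 S0geo S0q] := geodesic_segment_through geo xqy.
have [c1 [l1 h1]] := geo y z; have [c2 [l2 h2]] := geo z x.
have tri1 := metric_triangle x y z; have tri2 := metric_triangle y x z.
have tri3 := metric_triangle x z y.
have xz := metric_sym x z; have yz := metric_sym y z.
have xy := metric_sym x y; have qz := metric_sym q z.
have b0 := mdist_ge0 x z; have a0 := mdist_ge0 y z.
pose v (i : 'I_3) : X := match val i with 0%N => x | 1%N => y | _ => z end.
pose side (i : 'I_3) : set X := match val i with
  0%N => S0 | 1%N => c1 @` `[0, l1] | _ => c2 @` `[0, l2] end.
set a := mdist y z in a0 tri1 tri2 tri3 yz *.
set b := mdist x z in b0 tri1 tri2 tri3 xz *.
set c := mdist x y in sc c0 tri1 tri2 tri3 xy *.
(* the law of cosines at the vertex corresponding to x *)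
pose e := (b ^+ 2 + c ^+ 2 - a ^+ 2) / (2 * c).
have ce : 2 * c * e = b ^+ 2 + c ^+ 2 - a ^+ 2.
  by rewrite /e mulrC divfK// mulf_neq0 ?gt_eqF.
(* Heron's factorisation: the height exists by the triangle inequalities *)
have f0 : 0 <= b ^+ 2 - e ^+ 2.
  have : 0 <= (2 * c) ^+ 2 * (b ^+ 2 - e ^+ 2).
    have -> : (2 * c) ^+ 2 * (b ^+ 2 - e ^+ 2) =
       ((b + c - a) * (b + c + a)) * ((a - b + c) * (a + b - c)).
      by rewrite mulrBr -exprMn -exprMn ce; ring.
    by apply: mulr_ge0; apply: mulr_ge0; lra.
  by rewrite pmulr_rge0// exprn_gt0//; lra.
pose f := Num.sqrt (b ^+ 2 - e ^+ 2).
have ff : f ^+ 2 = b ^+ 2 - e ^+ 2 by rewrite sqr_sqrtr.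
pose v' (i : 'I_3) : 'rV[R]_2 := match val i with
  0%N => plane_point 0 0 | 1%N => plane_point c 0 | _ => plane_point e f end.
have v00 (g k : R) : euclidean_dist (plane_point g k) (plane_point g k) = 0.
  by rewrite euclidean_dist_plane_point !subrr expr0n/= addr0 sqrtr0.
have v01 : euclidean_dist (plane_point 0 0) (plane_point c 0) = c.
  rewrite euclidean_dist_plane_point subrr expr0n/= addr0 sub0r sqrrN.
  by rewrite sqrtr_sqr gtr0_norm.
have v02 : euclidean_dist (plane_point 0 0) (plane_point e f) = b.
  rewrite euclidean_dist_plane_point !sub0r !sqrrN ff addrC subrK.
  by rewrite sqrtr_sqr ger0_norm.
have v12 : euclidean_dist (plane_point c 0) (plane_point e f) = a.
  rewrite euclidean_dist_plane_point sub0r sqrrN ff.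
  have -> : (c - e) ^+ 2 + (b ^+ 2 - e ^+ 2) = c ^+ 2 + b ^+ 2 - 2 * c * e.
    by ring.
  have -> : c ^+ 2 + b ^+ 2 - 2 * c * e = a ^+ 2 by rewrite ce; ring.
  by rewrite sqrtr_sqr ger0_norm.
have vC (g k g' k' : R) :
    euclidean_dist (plane_point g k) (plane_point g' k')
    = euclidean_dist (plane_point g' k') (plane_point g k).
  rewrite !euclidean_dist_plane_point.
  by rewrite -[in RHS](sqrrN (g' - g)) -[in RHS](sqrrN (k' - k)) !opprB.
have tri : geodesic_triangle v side.
  case=> [[|[|[|//]]] ?] //.
  - by exists c1, l1.
  - by exists c2, l2.
have comp : comparison_triangle v v'.
  case=> [[|[|[|//]]] ?]; case=> [[|[|[|//]]] ?]; rewrite /v/v'/= ?mdistxx//.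
  - by rewrite vC v01 metric_sym.
  - by rewrite vC v02 metric_sym.
  - by rewrite vC v12 metric_sym.
have cpq : comparison_point v v' ord0 q (plane_point s 0).
  split; last first.
    rewrite /v/v'/= euclidean_dist_plane_point subrr expr0n/= addr0 sub0r sqrrN.
    by rewrite sqrtr_sqr ger0_norm//; case: xqy.
  exists (s / c).
    by rewrite /= in_itv/= divr_ge0 ?(ltW c0)//= ler_pdivrMr// mul1r.
  apply/rowP => k; rewrite /v'/= !mxE.
  case: ifP => _; rewrite ?mulr0 ?addr0 ?add0r//.
  by rewrite divfK// gt_eqF.
have cpz : comparison_point v v' ord_max z (plane_point e f).
  split; last by rewrite /v/v'/= v00 mdistxx.
  exists 0; first by rewrite /= in_itv/= lexx ler01.
  by rewrite subr0 scale1r scale0r addr0.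
have sz : side ord_max z.
  by case: h2 => l0 cz _ _; exists 0 => //=; rewrite in_itv/= lexx l0.
have := cat v side v' tri comp ord0 ord_max q z _ _ S0q sz cpq cpz.
rewrite euclidean_dist_plane_point => qz_le.
have qz2_le : mdist q z ^+ 2 <= (s - e) ^+ 2 + (0 - f) ^+ 2.
  have rhs0 : 0 <= (s - e) ^+ 2 + (0 - f) ^+ 2.
    by apply: addr_ge0; exact: sqr_ge0.
  by rewrite -(sqr_sqrtr rhs0) lerXn2r// nnegrE ?mdist_ge0// sqrtr_ge0.
have : c * mdist q z ^+ 2 <= c * ((s - e) ^+ 2 + (0 - f) ^+ 2).
  by rewrite ler_pM2l.
have -> : c * ((s - e) ^+ 2 + (0 - f) ^+ 2) =
    c * s ^+ 2 - s * (2 * c * e) + c * e ^+ 2 + c * f ^+ 2 by ring.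
rewrite ce ff => /le_trans; apply.
by rewrite le_eqVlt; apply/orP; left; apply/eqP; ring.
Qed.

(** Radial projection to a ball around [p] is 1-Lipschitz. Two applications of
    [stewart_le] give [ab d(x',y')^2 <= r^2 (d(x,y)^2 - (a - b)^2)] with
    [a = d(p,x)] and [b = d(p,y)], the value found in the plane. *)
Lemma radial_projection_le p x y r x' y' : CAT0_space X -> 0 <= r ->
  r <= mdist p x -> r <= mdist p y -> point_at p x r x' -> point_at p y r y' ->
  mdist x' y' <= mdist x y.
Proof.
move=> cat r0 rx ry hx hy.
have [px x'x] := hx; have [py y'y] := hy.
have c0 := mdist_ge0 x y; have e0 := mdist_ge0 x' y'.
move: r0; rewrite le_eqVlt => /predU1P[r0|r0].
  have := metric_triangle x' p y'; rewrite (metric_sym x' p) px py; lra.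
have H1 := stewart_le y cat (ltW r0) rx hx.
have := stewart_le x' cat (ltW r0) ry hy.
rewrite px (metric_sym y x') (metric_sym y' x') => H2.
move: H1 H2 c0 e0 rx ry.
move: (mdist x' y') (mdist x y) (mdist x' y) (mdist p x) (mdist p y).
move=> e c d a b H1 H2 c0 e0 ra rb.
have a0 : 0 < a by lra.
have b0 : 0 < b by lra.
have H3 : a * (b * e ^+ 2) <=
    a * ((b - r) * r ^+ 2 + r * d ^+ 2 - r * (b - r) * b) by rewrite ler_pM2l.
have H4 : r * (a * d ^+ 2) <=
    r * ((a - r) * b ^+ 2 + r * c ^+ 2 - r * (a - r) * a) by rewrite ler_pM2l.
have H5 : (a * b) * e ^+ 2 <= r ^+ 2 * (c ^+ 2 - (a - b) ^+ 2).
  have -> : r ^+ 2 * (c ^+ 2 - (a - b) ^+ 2) =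
      r * ((a - r) * b ^+ 2 + r * c ^+ 2 - r * (a - r) * a)
      + a * ((b - r) * r ^+ 2 + r * d ^+ 2 - r * (b - r) * b)
      - r * (a * d ^+ 2) by ring.
  lra.
have H6 : (a * b) * e ^+ 2 <= (a * b) * c ^+ 2.
  apply: le_trans H5 _.
  apply: (@le_trans _ _ (r ^+ 2 * c ^+ 2)).
    by rewrite ler_pM2l ?exprn_gt0// gerBl sqr_ge0.
  by rewrite ler_wpM2r ?sqr_ge0// expr2 ler_pM// ltW.
by move: H6; rewrite ler_pM2l ?mulr_gt0// ler_sqr.
Qed.

(** Since [w] and [u'] lie on a common sphere around [p] and [u] lies radially
    outside [u'], the angle at [u'] between [u] and [w] is at least a right
    angle, and the Pythagorean theorem becomes an inequality. *)
Lemma diagonal_ge p u u' w t h : CAT0_space X -> 0 <= t -> 0 < h ->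
  mdist p u = t + h -> mdist p w = t -> point_at p u t u' ->
  h ^+ 2 + mdist u' w ^+ 2 <= mdist u w ^+ 2.
Proof.
move=> cat t0 h0 pu pw hu; have [pu' u'u] := hu.
have [t_eq0|t_gt0] := leP t 0.
  have pwE : p = w by apply: mdist_positivity; lra.
  have pu'E : p = u' by apply: mdist_positivity; lra.
  have t00 : t = 0 by lra.
  by rewrite -pwE -pu'E mdistxx metric_sym pu t00 expr0n/= addr0 add0r.
have tu : t <= mdist p u by lra.
have := stewart_le w cat t0 tu hu; rewrite pu pw => H.
rewrite -(@ler_pM2l _ t)//.
by have := mulr_ge0 (ltW h0) (sqr_ge0 (mdist u' w)); lra.
Qed.

(** * Contraction towards a point *)

(** Write [e = d(u',v')]. The diagonals satisfy
    [2 sqrt (h^2 + e^2) <= d(u,v') + d(v,u') <= 41/40 (3h/2 + e) + h/10] once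
    [e > h/2], because then [d(u,v) + e] and [2h] are both at most [3h/2 + e].
    The left side is at least [sqrt 3 h + e], and [sqrt 3 > 3/2] leaves enough
    room for the errors [1/40] and [2 delta <= h/10]. *)
Lemma contraction p u v u' v' t h delta : CAT0_space X ->
  four_point_inequality X (41 / 40) delta -> 0 < h -> 20 * delta <= h ->
  0 <= t -> mdist p u = t + h -> mdist p v = t + h ->
  point_at p u t u' -> point_at p v t v' ->
  2 * mdist u v <= 3 * h -> 2 * mdist u' v' <= h.
Proof.
move=> cat fp h0 hdelta t0 pu pv hu hv uv.
have uu' : mdist u' u = h by case: hu => _ ->; lra.
have vv' : mdist v' v = h by case: hv => _ ->; lra.
have := diagonal_ge cat t0 h0 pu (proj1 hv) hu.
have := diagonal_ge cat t0 h0 pv (proj1 hu) hv.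
have := fp u v' v u'; rewrite (metric_sym u u') uu' vv' (metric_sym v' u').
move: uv (mdist_ge0 u v') (mdist_ge0 v u') (mdist_ge0 u' v').
move: (mdist u' v') (mdist u v) (mdist u v') (mdist v u').
move=> e d D1 D2 d_le D10 D20 e0 sum_le D2_ge D1_ge.
rewrite leNgt; apply/negP => eh.
have max_le : Num.max (d + e) (h + h) <= 3 / 2 * h + e.
  by rewrite ge_max; apply/andP; split; lra.
have D_le : D1 + D2 <= 41 / 40 * (3 / 2 * h + e) + h / 10 by lra.
have D2_le : (D1 + D2) ^+ 2 <= (41 / 40 * (3 / 2 * h + e) + h / 10) ^+ 2.
  by rewrite ler_sqr ?nnegrE; lra.
have D_ge : 4 * (h ^+ 2 + e ^+ 2) <= (D1 + D2) ^+ 2.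
  have D12_ge : h ^+ 2 + e ^+ 2 <= D1 * D2.
    have s0 : 0 <= h ^+ 2 + e ^+ 2 by apply: addr_ge0; exact: sqr_ge0.
    rewrite -ler_sqr ?nnegrE ?mulr_ge0// exprMn [_ ^+ 2]expr2.
    exact: ler_pM.
  by have := sqr_ge0 (D1 - D2); lra.
have := le_trans D_ge D2_le; apply/negP; rewrite -ltNge.
(* the difference is a positive definite quadratic form in h and e, which for
   fixed h is minimal near e = 0.57 h *)
have := sqr_ge0 (e - 57 / 100 * h); have := mulr_ge0 (ltW h0) e0.
have : 0 < h ^+ 2 by rewrite exprn_gt0.
lra.
Qed.

(** Induction on the number of steps of length [h] from [u] to [m]. Let [w] be
    the point one step before [m]. By induction the projections of [u] and [w]
    to the sphere of radius [r + h] are [3h/2]-close, hence those to radius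
    [r] are [h/2]-close by [contraction]; the last step adds at most [h]. The
    radius [r + h] is admissible for [w] since [d(u,w) = d(u,m) - h]. *)
Lemma fellow_travel n p u m u' m' r h delta : CAT0_space X ->
  four_point_inequality X (41 / 40) delta -> 0 < h -> 20 * delta <= h ->
  0 <= r -> mdist u m <= n%:R * h -> r <= mdist p u - mdist u m ->
  point_at p u r u' -> point_at p m r m' -> 2 * mdist u' m' <= 3 * h.
Proof.
move=> cat fp h0 hdelta; have [geo _] := cat.
have short q q' z z' s : 0 <= s -> mdist q z <= h -> s <= mdist p q ->
    s <= mdist p z -> point_at p q s q' -> point_at p z s z' ->
    mdist q' z' <= h.
  move=> s0 qz sq sz hq hz; apply: le_trans qz.
  exact: (@radial_projection_le p q z s).
elim: n m m' r u' => [|n IH] m m' r u' r0 umn rum hu hm.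
  have um0 := mdist_ge0 u m; have tri := metric_triangle p m u.
  rewrite (metric_sym m u) in tri.
  by have : mdist u' m' <= h; [apply: (short u u' m m' r) => //|]; lra.
have um0 := mdist_ge0 u m; have tri := metric_triangle p m u.
rewrite (metric_sym m u) in tri.
have [umh|umh] := leP (mdist u m) h.
  by have : mdist u' m' <= h; [apply: (short u u' m m' r) => //|]; lra.
have [||w [mw wu]] := @point_at_exists m u h geo.
- lra.
- by rewrite (metric_sym m u); lra.
rewrite (metric_sym m u) in wu; rewrite (metric_sym m w) in mw.
have uw := metric_sym u w; have pwu := metric_triangle p w u.
have [||w' hw] := @point_at_exists p w r geo; [lra|lra|].
have [_ u'u] := hu; have [_ w'w] := hw.
have [||u'' hu''] := @point_at_exists u' u h geo; [lra|lra|].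
have [||w'' hw''] := @point_at_exists w' w h geo; [lra|lra|].
have [hu1 hu2] := point_at_extend hu hu''.
have [hw1 hw2] := point_at_extend hw hw''.
have uw'' : 2 * mdist u'' w'' <= 3 * h.
  by apply: (IH w _ (r + h)) => //; lra.
have uw' : 2 * mdist u' w' <= h.
  exact: (contraction cat fp h0 hdelta r0 (proj1 hu1) (proj1 hw1) hu2 hw2 uw'').
have wm' : mdist w' m' <= h by apply: (short w w' m m' r) => //; lra.
by have := metric_triangle u' w' m'; lra.
Qed.

(** * Gromov hyperbolicity *)

(** The geodesics from [p] to [u] and [v] are close up to the Gromov product
    of [u] and [v] based at [p]. The point [m] of [[u,v]] is where the tripod
    with ends [p], [u], [v] branches, so that [fellow_travel] applies to
    [[u,m]] and to [[v,m]]. *)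
Lemma gromov_product_fellow_travel p u v u' v' t h delta : CAT0_space X ->
  four_point_inequality X (41 / 40) delta -> 0 < h -> 20 * delta <= h ->
  0 <= t -> 2 * t <= mdist p u + mdist p v - mdist u v ->
  point_at p u t u' -> point_at p v t v' -> mdist u' v' <= 3 * h.
Proof.
move=> cat fp h0 hdelta t0 tg hu hv; have [geo _] := cat.
have tri1 := metric_triangle p u v; have tri2 := metric_triangle p v u.
rewrite (metric_sym v u) in tri2.
pose s := (mdist p u + mdist u v - mdist p v) / 2.
have sE : 2 * s = mdist p u + mdist u v - mdist p v by rewrite /s; lra.
have [||m [um mv]] := @point_at_exists u v s geo; [lra|lra|].
have vm := metric_sym v m.
have tri3 := metric_triangle p m u; rewrite (metric_sym m u) in tri3.
have [||m' hm] := @point_at_exists p m t geo; [lra|lra|].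
have bound x : mdist x m <= (Num.bound (mdist x m / h))%:R * h.
  rewrite -ler_pdivrMr//; apply/ltW/archi_boundP.
  by rewrite divr_ge0 ?mdist_ge0// ltW.
have um' : 2 * mdist u' m' <= 3 * h.
  by apply: (fellow_travel cat fp h0 hdelta t0 (bound u) _ hu hm); lra.
have vm' : 2 * mdist v' m' <= 3 * h.
  by apply: (fellow_travel cat fp h0 hdelta t0 (bound v) _ hv hm); lra.
by have := metric_triangle u' m' v'; rewrite (metric_sym m' v'); lra.
Qed.

(** Take as base point [p] one of the four points, and let [t] be the smaller
    of the Gromov products of [x], [z] and of [y], [z]. The points at distance
    [t] from [p] towards [x] and [y] are both [3h]-close to the one towards
    [z]; going from [x] to [y] through them bounds [d(x,y)]. *)
Lemma almost_tree_gromov_hyperbolic delta : CAT0_space X -> 0 <= delta ->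
  four_point_inequality X (41 / 40) delta -> gromov_hyperbolic X.
Proof.
move=> cat d0 fp; have [geo _] := cat.
pose h := 20 * delta + 1.
have h0 : 0 < h by rewrite /h; lra.
have hdelta : 20 * delta <= h by rewrite /h; lra.
exists (3 * h); first by lra.
move=> x y z p; rewrite mul1r (metric_sym y p) (metric_sym z p) (metric_sym x p).
set M := Num.max _ _.
have M1 : mdist x z + mdist p y <= M by rewrite le_max lexx.
have M2 : mdist p x + mdist y z <= M by rewrite le_max lexx orbT.
have txz := metric_triangle p x z; have tyz := metric_triangle p y z.
have tzx := metric_triangle p z x; have tzy := metric_triangle p z y.
have txy := metric_triangle x p y; have txzp := metric_triangle x p z.
have tyzp := metric_triangle y p z.
rewrite (metric_sym x p) in txy txzp; rewrite (metric_sym y p) in tyzp.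
rewrite (metric_sym z x) in tzx; rewrite (metric_sym z y) in tzy.
pose t := (mdist p x + mdist p y + mdist p z - M) / 2.
have tE : 2 * t = mdist p x + mdist p y + mdist p z - M by rewrite /t; lra.
have t0 : 0 <= t.
  have : M <= mdist p x + mdist p y + mdist p z.
    by rewrite ge_max; apply/andP; split; lra.
  lra.
have [||x' hx] := @point_at_exists p x t geo; [lra|lra|].
have [||y' hy] := @point_at_exists p y t geo; [lra|lra|].
have [||z' hz] := @point_at_exists p z t geo; [lra|lra|].
have xz' : mdist x' z' <= 3 * h.
  by apply: (gromov_product_fellow_travel cat fp h0 hdelta t0 _ hx hz); lra.
have yz' : mdist y' z' <= 3 * h.
  by apply: (gromov_product_fellow_travel cat fp h0 hdelta t0 _ hy hz); lra.
have [_ x'x] := hx; have [_ y'y] := hy.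
have := metric_triangle x x' y; have := metric_triangle x' y' y.
have := metric_triangle x' z' y'.
by rewrite (metric_sym z' y') (metric_sym x x'); lra.
Qed.

End CAT0Hyperbolicity.

Theorem proposition3p8 (R : realType) (X : metricType R) :
  proper_space X -> CAT0_space X ->
  quasi_hyperbolicity_constant X = 1 -> gromov_hyperbolic X.
Proof.
move=> _ cat C1.
set S : set R := [set mu : R | 0 <= mu /\
        exists2 delta : R, 0 <= delta & four_point_inequality X mu delta].
have infS : inf S = 1 by exact: C1.
(* an infimum that does not exist is 0 by convention, so the value 1 is
   approached by elements of S *)
have S0 : has_inf S.
  by apply: contrapT => /inf_out /eqP; rewrite infS oner_eq0.
have [|mu [_ [delta d0 fp]]] := @inf_adherent _ S (1 / 40) _ S0; first lra.
rewrite infS => mu_lt.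
apply: (almost_tree_gromov_hyperbolic cat d0) => x y z w.
apply: le_trans (fp x y z w) _; rewrite lerD2r ler_wpM2r//; last by lra.
by rewrite le_max addr_ge0 ?mdist_ge0.
Qed.
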